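(* Let $\omega$ be the symmetric sum, $\omega(x,y,z) = x(y\circ z) + y(z\circ x) + z(x\circ y)$, where $u \circ v = \tfrac12(uv+vu)$. In $U(A^\omega)$ the following relations hold: \[ a^3 = b^3 = 0, \qquad b^2 a = -bab - ab^2 + b, \qquad ba^2 = -aba - a^2 b + a. \] Hence $U(A^\omega)$ is the quotient of the down-up algebra $A(-1,-1,1)$ by the two-sided ideal generated by $a^3$ and $b^3$.
   Context: $\mathbb{F}$ is a field of characteristic $0$. $A$ is the 2-dimensional space of $2\times 2$ matrices over $\mathbb{F}$ with zero diagonal, with basis $e_1 = \begin{bmatrix} 0&1\\0&0\end{bmatrix}$, $e_2 = \begin{bmatrix} 0&0\\1&0\end{bmatrix}$; it is closed under triple products $xyz$ of matrices. For a trilinear operation $\omega(x,y,z)$ (a fixed rational linear combination of the six products of $x,y,z$ in all orders), $A^\omega$ denotes the space $A$ with the trilinear operation $\omega$ computed using matrix multiplication. Let $\mathbb{F}\langle a,b\rangle$ be the free unital associative algebra and $\phi\colon A \to \mathbb{F}\langle a,b\rangle$ the linear map with $\phi(e_1)=a$, $\phi(e_2)=b$. The universal associative envelope is $U(A^\omega) = \mathbb{F}\langle a,b\rangle / I$, where $I$ is the two-sided ideal generated by the elements $\omega(\phi(x),\phi(y),\phi(z)) - \phi(\omega(x,y,z))$ for $x,y,z\in\{e_1,e_2\}$. The cosets of $a,b$ in $U(A^\omega)$ are again written $a,b$. For $\alpha,\beta,\gamma\in\mathbb{F}$, the down-up algebra $A(\alpha,\beta,\gamma)$ is the unital associative $\mathbb{F}$-algebra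 with generators $a,b$ and relations $b^2a = \alpha bab + \beta ab^2 + \gamma b$ and $ba^2 = \alpha aba + \beta a^2 b + \gamma a$. *)

(* Defs.v *)
From HB Require Import structures.
From mathcomp Require Import all_boot all_algebra.
From mathcomp Require Import boolp monalg.

Set Implicit Arguments.
Unset Strict Implicit.
Unset Printing Implicit Defensive.

Import GRing.Theory.
Local Open Scope ring_scope.
Local Open Scope quotient_scope.

(* MathComp's ring quotients are only for commutative rings. *)
Section TwoSidedIdeals.
Variable B : nzRingType.

(* Closure under opposite follows by multiplying with -1; over a unital       *)
(* algebra, closure under scaling follows likewise.                           *)
Definition two_sided_ideal (I : B -> Prop) : Prop :=
  [/\ I 0, forall x y, I x -> I y -> I (x + y)
    & forall u x v, I x -> I (u * x * v)].

Definition ideal_gen (S : B -> Prop) (x : B) : Prop :=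
  forall I : B -> Prop, two_sided_ideal I -> (forall s, S s -> I s) -> I x.

Lemma ideal_gen_ideal S : two_sided_ideal (ideal_gen S).
Proof.
split=> [I [] // | x y Sx Sy I idI SI | u x v Sx I idI SI].
  by case: (idI) => _ addI _; apply: addI; [apply: Sx | apply: Sy].
by case: (idI) => _ _ mulI; apply: mulI; apply: Sx.
Qed.

Lemma ideal_gen_sub (S : B -> Prop) x : S x -> ideal_gen S x.
Proof. by move=> Sx I _; apply. Qed.

Definition ideal_genb (S : B -> Prop) : {pred B} :=
  fun x => `[< ideal_gen S x >].

Lemma ideal_genP S x : reflect (ideal_gen S x) (x \in ideal_genb S).
Proof. exact: asboolP. Qed.

Lemma ideal_genMl S u x : x \in ideal_genb S -> u * x \in ideal_genb S.
Proof.
move=> /ideal_genP Sx; apply/ideal_genP.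
by have [_ _ /(_ u x 1 Sx)] := ideal_gen_ideal S; rewrite mulr1.
Qed.

Lemma ideal_genMr S x v : x \in ideal_genb S -> x * v \in ideal_genb S.
Proof.
move=> /ideal_genP Sx; apply/ideal_genP.
by have [_ _ /(_ 1 x v Sx)] := ideal_gen_ideal S; rewrite mul1r.
Qed.

Lemma ideal_gen_zmod S : zmod_closed (ideal_genb S).
Proof.
have [I0 ID _] := ideal_gen_ideal S; split=> [|x y Sx Sy].
  exact/ideal_genP.
have: -1 * y \in ideal_genb S by exact: ideal_genMl.
move: Sx => /ideal_genP Sx /ideal_genP Sy'; apply/ideal_genP.
by rewrite -mulN1r; apply: ID.
Qed.

HB.instance Definition _ S :=
  GRing.isZmodClosed.Build B (ideal_genb S) (ideal_gen_zmod S).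

End TwoSidedIdeals.

Section QuotientAlgebra.
Variables (F : fieldType) (B : algType F) (S : B -> Prop).

(* B / (S), the quotient by the two-sided ideal generated by S. The ideal is  *)
(* required to be proper because [algType] excludes the zero ring.            *)
Definition quot_alg of ~ ideal_gen S 1 : Type := Quotient.quot (ideal_genb S).

Hypothesis S_proper : ~ ideal_gen S 1.
Local Notation Q := (quot_alg S_proper).

HB.instance Definition _ := GRing.Zmodule.on Q.

Definition quot_pi (x : B) : Q := \pi_(Quotient.quot (ideal_genb S)) x.

Lemma quot_piP x y :
  reflect (quot_pi x = quot_pi y) (x - y \in ideal_genb S).
Proof. by rewrite Quotient.idealrBE; apply: eqP. Qed.

Lemma quot_pi_surj (q : Q) : exists x, q = quot_pi x.
Proof. by exists (repr (q : Quotient.quot _)); rewrite /quot_pi reprK. Qed.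

Lemma quot_pi_is_zmod_morphism : zmod_morphism quot_pi.
Proof. exact: (raddfB (\pi_(Quotient.quot (ideal_genb S)))). Qed.

Lemma quot_piD : {morph quot_pi : x y / x + y}.
Proof. exact: (raddfD (\pi_(Quotient.quot (ideal_genb S)))). Qed.

HB.instance Definition _ :=
  GRing.isZmodMorphism.Build B Q quot_pi quot_pi_is_zmod_morphism.

Definition quot_repr (q : Q) : B := repr (q : Quotient.quot (ideal_genb S)).

Lemma quot_reprK q : quot_pi (quot_repr q) = q.
Proof. exact: reprK. Qed.

Definition quot_one : Q := quot_pi 1.
Definition quot_mul (p q : Q) : Q :=
  quot_pi (quot_repr p * quot_repr q).
Definition quot_scale (c : F) (q : Q) : Q :=
  quot_pi (c *: quot_repr q).

Lemma quot_mul_pi x y : quot_mul (quot_pi x) (quot_pi y) = quot_pi (x * y).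
Proof.
apply/quot_piP; set x' := quot_repr _; set y' := quot_repr _.
have xP : x' - x \in ideal_genb S by apply/quot_piP; rewrite quot_reprK.
have yP : y' - y \in ideal_genb S by apply/quot_piP; rewrite quot_reprK.
have -> : x' * y' - x * y = (x' - x) * y' + x * (y' - y).
  by rewrite mulrBl mulrBr addrA subrK.
by apply: rpredD; [apply: ideal_genMr | apply: ideal_genMl].
Qed.

Lemma quot_scale_pi c x : quot_scale c (quot_pi x) = quot_pi (c *: x).
Proof.
apply/quot_piP; set x' := quot_repr _.
have xP : x' - x \in ideal_genb S by apply/quot_piP; rewrite quot_reprK.
have -> : c *: x' - c *: x = (c *: 1) * (x' - x).
  by rewrite -scalerAl mul1r scalerBr.
exact: ideal_genMl.
Qed.

Fact quot_mulA : associative quot_mul.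
Proof.
move=> p q r; rewrite -[p]quot_reprK -[q]quot_reprK -[r]quot_reprK.
by rewrite !quot_mul_pi mulrA.
Qed.

Fact quot_mul1 : left_id quot_one quot_mul.
Proof. by move=> p; rewrite -[p]quot_reprK quot_mul_pi mul1r. Qed.

Fact quot_mulr1 : right_id quot_one quot_mul.
Proof. by move=> p; rewrite -[p]quot_reprK quot_mul_pi mulr1. Qed.

Fact quot_mulDl : left_distributive quot_mul +%R.
Proof.
move=> p q r; rewrite -[p]quot_reprK -[q]quot_reprK -[r]quot_reprK.
by rewrite -raddfD !quot_mul_pi mulrDl raddfD.
Qed.

Fact quot_mulDr : right_distributive quot_mul +%R.
Proof.
move=> p q r; rewrite -[p]quot_reprK -[q]quot_reprK -[r]quot_reprK.
by rewrite -raddfD !quot_mul_pi mulrDr raddfD.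
Qed.

Fact quot_one_neq0 : quot_one != 0.
Proof.
apply/eqP; rewrite -(raddf0 quot_pi) => /quot_piP.
by rewrite subr0 => /ideal_genP.
Qed.

HB.instance Definition _ := GRing.Zmodule_isNzRing.Build Q
  quot_mulA quot_mul1 quot_mulr1 quot_mulDl quot_mulDr quot_one_neq0.

Lemma quot_pi_is_monoid_morphism : monoid_morphism quot_pi.
Proof. by split=> // x y; rewrite -quot_mul_pi. Qed.

HB.instance Definition _ :=
  GRing.isMonoidMorphism.Build B Q quot_pi quot_pi_is_monoid_morphism.

Lemma quot_piM : {morph quot_pi : x y / x * y}.
Proof. exact: rmorphM. Qed.

Fact quot_scaleA c d q : quot_scale c (quot_scale d q) = quot_scale (c * d) q.
Proof. by rewrite -[q]quot_reprK !quot_scale_pi scalerA. Qed.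

Fact quot_scale1 : left_id 1 quot_scale.
Proof. by move=> q; rewrite -[q]quot_reprK quot_scale_pi scale1r. Qed.

Fact quot_scaleDr : right_distributive quot_scale +%R.
Proof.
move=> c p q; rewrite -[p]quot_reprK -[q]quot_reprK.
by rewrite -raddfD !quot_scale_pi scalerDr raddfD.
Qed.

Fact quot_scaleDl q : {morph quot_scale^~ q : c d / c + d}.
Proof.
by move=> c d; rewrite -[q]quot_reprK !quot_scale_pi scalerDl raddfD.
Qed.

HB.instance Definition _ := GRing.Zmodule_isLmodule.Build F Q
  quot_scaleA quot_scale1 quot_scaleDr quot_scaleDl.

Lemma quot_piZ : scalable quot_pi.
Proof. by move=> c x; rewrite -quot_scale_pi. Qed.

HB.instance Definition _ :=
  GRing.isScalable.Build F B Q *:%R quot_pi quot_piZ.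

Fact quot_scalerAl (c : F) (p q : Q) : c *: (p * q) = (c *: p) * q.
Proof.
have [x ->] := quot_pi_surj p; have [y ->] := quot_pi_surj q.
by rewrite -(quot_piZ c x) -!quot_piM -quot_piZ scalerAl.
Qed.

HB.instance Definition _ :=
  GRing.Lmodule_isLalgebra.Build F Q quot_scalerAl.

Fact quot_scalerAr (c : F) (p q : Q) : c *: (p * q) = p * (c *: q).
Proof.
have [x ->] := quot_pi_surj p; have [y ->] := quot_pi_surj q.
by rewrite -(quot_piZ c y) -!quot_piM -quot_piZ scalerAr.
Qed.

HB.instance Definition _ :=
  GRing.Lalgebra_isAlgebra.Build F Q quot_scalerAr.

End QuotientAlgebra.

Fact malg_scalerAr (K : monomType) (F : comNzRingType) (c : F)
    (x y : {malg F[K]}) : c *: (x * y) = x * (c *: y).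
Proof.
apply/malgP => k; rewrite mcoeffZ mcoeffMl.
rewrite (mcoeffMlw _ (finmap.fsubset_refl _) (msuppZ_le c y)) mulr_sumr.
apply: eq_bigr => k1 _; rewrite mulr_sumr; apply: eq_bigr => k2 _.
by rewrite mcoeffZ mulrnAr mulrCA.
Qed.

(* F<a,b>, as the monoid algebra of the free monoid on two letters. The       *)
(* operations are those of [malg], locked because unification would otherwise *)
(* compute in the monoid algebra.                                             *)
Definition free2 (F : fieldType) : Type := {malg F[{fmonom 'I_2}]}.

HB.lock Definition free_add (F : fieldType) (x y : free2 F) : free2 F :=
  (x : {malg F[{fmonom 'I_2}]}) + y.
HB.lock Definition free_opp (F : fieldType) (x : free2 F) : free2 F :=
  - (x : {malg F[{fmonom 'I_2}]}).
HB.lock Definition free_zero (F : fieldType) : free2 F :=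
  0 : {malg F[{fmonom 'I_2}]}.
HB.lock Definition free_mul (F : fieldType) (x y : free2 F) : free2 F :=
  (x : {malg F[{fmonom 'I_2}]}) * y.
HB.lock Definition free_one (F : fieldType) : free2 F :=
  1 : {malg F[{fmonom 'I_2}]}.
HB.lock Definition free_scale (F : fieldType) (c : F) (x : free2 F) : free2 F :=
  c *: (x : {malg F[{fmonom 'I_2}]}).
HB.lock Definition free_gen (F : fieldType) (i : 'I_2) : free2 F :=
  << fmu i >>%R.

Section FreeAlgebraOperations.
Variable F : fieldType.
Local Notation add := (@free_add F).
Local Notation mul := (@free_mul F).
Local Notation scale := (@free_scale F).

HB.instance Definition _ := Choice.on (free2 F).

Fact free_addA : associative add.
Proof. by move=> x y z; rewrite free_add.unlock addrA. Qed.
Fact free_addC : commutative add.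
Proof. by move=> x y; rewrite free_add.unlock addrC. Qed.
Fact free_add0 : left_id (free_zero F) add.
Proof. by move=> x; rewrite free_add.unlock free_zero.unlock add0r. Qed.
Fact free_addN : left_inverse (free_zero F) (@free_opp F) add.
Proof.
by move=> x; rewrite free_add.unlock free_opp.unlock free_zero.unlock addNr.
Qed.
HB.instance Definition _ := GRing.isZmodule.Build (free2 F)
  free_addA free_addC free_add0 free_addN.

Fact free_mulA : associative mul.
Proof. by move=> x y z; rewrite free_mul.unlock mulrA. Qed.
Fact free_mul1 : left_id (free_one F) mul.
Proof. by move=> x; rewrite free_mul.unlock free_one.unlock mul1r. Qed.
Fact free_mulr1 : right_id (free_one F) mul.
Proof. by move=> x; rewrite free_mul.unlock free_one.unlock mulr1. Qed.
Fact free_mulDl : left_distributive mul add.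
Proof. by move=> x y z; rewrite free_mul.unlock free_add.unlock mulrDl. Qed.
Fact free_mulDr : right_distributive mul add.
Proof. by move=> x y z; rewrite free_mul.unlock free_add.unlock mulrDr. Qed.
Fact free_one_neq0 : free_one F != free_zero F.
Proof. by rewrite free_one.unlock free_zero.unlock oner_neq0. Qed.
HB.instance Definition _ := GRing.Zmodule_isNzRing.Build (free2 F)
  free_mulA free_mul1 free_mulr1 free_mulDl free_mulDr free_one_neq0.

Fact free_scaleA c d x : scale c (scale d x) = scale (c * d) x.
Proof. by rewrite free_scale.unlock scalerA. Qed.
Fact free_scale1 : left_id 1 scale.
Proof. by move=> x; rewrite free_scale.unlock scale1r. Qed.
Fact free_scaleDr : right_distributive scale add.
Proof. by move=> c x y; rewrite free_scale.unlock free_add.unlock scalerDr. Qed.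
Fact free_scaleDl x : {morph scale^~ x : c d / c + d >-> add c d}.
Proof. by move=> c d; rewrite free_scale.unlock free_add.unlock scalerDl. Qed.
HB.instance Definition _ := GRing.Zmodule_isLmodule.Build F (free2 F)
  free_scaleA free_scale1 free_scaleDr free_scaleDl.

Fact free_scalerAl (c : F) (x y : free2 F) : c *: (x * y) = (c *: x) * y.
Proof.
change (scale c (mul x y) = mul (scale c x) y).
by rewrite free_scale.unlock free_mul.unlock; apply: scalerAl.
Qed.
HB.instance Definition _ :=
  GRing.Lmodule_isLalgebra.Build F (free2 F) free_scalerAl.

Fact free_scalerAr (c : F) (x y : free2 F) : c *: (x * y) = x * (c *: y).
Proof.
change (scale c (mul x y) = mul x (scale c y)).
by rewrite free_scale.unlock free_mul.unlock; apply: malg_scalerAr.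
Qed.
HB.instance Definition _ :=
  GRing.Lalgebra_isAlgebra.Build F (free2 F) free_scalerAr.

End FreeAlgebraOperations.

Section FreeAlgebra.
Variable F : fieldType.
Local Notation FF := (free2 F).

Definition free_a : FF := free_gen F ord0.
Definition free_b : FF := free_gen F ord_max.

(* The augmentation a, b |-> 0, used only to show that ideals are proper *)
Definition aug : FF -> F := @mcoeff {fmonom 'I_2} F mone.

Fact aug_is_zmod_morphism : zmod_morphism aug.
Proof.
move=> x y; change (aug (free_add x (free_opp y)) = aug x - aug y).
by rewrite free_add.unlock free_opp.unlock /aug mcoeffB.
Qed.

Fact aug_is_monoid_morphism : monoid_morphism aug.
Proof.
split=> [|x y]; first by change (aug (free_one F) = 1);
  rewrite free_one.unlock /aug rmorph1.
change (aug (free_mul x y) = aug x * aug y).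
by rewrite free_mul.unlock /aug; apply: rmorphM.
Qed.

HB.instance Definition _ :=
  GRing.isZmodMorphism.Build FF F aug aug_is_zmod_morphism.
HB.instance Definition _ :=
  GRing.isMonoidMorphism.Build FF F aug aug_is_monoid_morphism.

Lemma aug1 : aug 1 = 1.
Proof. exact: rmorph1. Qed.

Lemma augB : {morph aug : x y / x - y}.
Proof. exact: raddfB. Qed.

Lemma augD : {morph aug : x y / x + y}.
Proof. exact: raddfD. Qed.

Lemma augM : {morph aug : x y / x * y}.
Proof. exact: rmorphM. Qed.

Lemma augZ c x : aug (c *: x) = c * aug x.
Proof.
change (aug (free_scale c x) = c * aug x).
by rewrite free_scale.unlock /aug; apply: mcoeffZ.
Qed.

Lemma aug_gen i : aug (free_gen F i) = 0.
Proof. by rewrite /aug free_gen.unlock mcoeffU fm1_eq1. Qed.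

Lemma aug_a : aug free_a = 0. Proof. exact: aug_gen. Qed.
Lemma aug_b : aug free_b = 0. Proof. exact: aug_gen. Qed.

Lemma ideal_gen_aug (S : FF -> Prop) :
  (forall s, S s -> aug s = 0) -> forall x, ideal_gen S x -> aug x = 0.
Proof.
move=> S0 x Sx; apply: (Sx (fun y => aug y = 0)) => //.
split=> [|y z y0 z0|u y v y0]; first exact: raddf0.
  by rewrite augD y0 z0 addr0.
by rewrite !augM y0 mulr0 mul0r.
Qed.

Lemma aug_proper (S : FF -> Prop) :
  (forall s, S s -> aug s = 0) -> ~ ideal_gen S 1.
Proof.
by move=> /ideal_gen_aug S0 /S0 /eqP; rewrite rmorph1 oner_eq0.
Qed.

Lemma aug_proper2 (S : FF -> Prop) (S_proper : ~ ideal_gen S 1)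
    (T : quot_alg S_proper -> Prop) :
  (forall s, S s -> aug s = 0) ->
  (forall t, T t -> exists2 x, t = quot_pi S_proper x & aug x = 0) ->
  ~ ideal_gen T 1.
Proof.
move=> /ideal_gen_aug S0 T0 T1.
have [||x x1 x0] := T1 (fun t => exists2 x, t = quot_pi S_proper x & aug x = 0).
- split=> [|_ _ [x -> x0] [y -> y0]|p _ q [x -> x0]].
  + by exists 0; rewrite raddf0.
  + exists (x + y); last by rewrite augD x0 y0 addr0.
    by rewrite quot_piD.
  + have [u ->] := quot_pi_surj p; have [v ->] := quot_pi_surj q.
    exists (u * x * v); last by rewrite !augM x0 mulr0 mul0r.
    by rewrite !quot_piM.
- exact: T0.
have /quot_piP/ideal_genP/S0 : quot_pi S_proper 1 = quot_pi S_proper x.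
  by rewrite -x1.
by rewrite augB x0 subr0 aug1 => /eqP; rewrite oner_eq0.
Qed.

End FreeAlgebra.

Section TrilinearOperation.
Variables (F : fieldType) (B : algType F).

(* u o v = (uv + vu) / 2 *)
Definition jordan (u v : B) : B := 2%:R^-1 *: (u * v + v * u).

Definition symsum (x y z : B) : B :=
  x * jordan y z + y * jordan z x + z * jordan x y.

End TrilinearOperation.

Section ZeroDiagonal.
Variable F : fieldType.

Definition zerodiag : {pred 'M[F]_2} := fun M => [forall i, M i i == 0].

Fact zerodiag_submod_closed : submod_closed zerodiag.
Proof.
split=> [|c M N /forallP M0 /forallP N0]; apply/forallP => i.
  by rewrite mxE.
by rewrite !mxE (eqP (M0 i)) (eqP (N0 i)) mulr0 addr0.
Qed.

HB.instance Definition _ :=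
  GRing.isSubmodClosed.Build F 'M[F]_2 zerodiag zerodiag_submod_closed.

(* The space A of 2 x 2 matrices with zero diagonal *)
Record zdmx : predArgType := ZDmx { zdval : 'M[F]_2; _ : zdval \in zerodiag }.

HB.instance Definition _ := [isSub for zdval].
HB.instance Definition _ := [Choice of zdmx by <:].
HB.instance Definition _ := [SubChoice_isSubLmodule of zdmx by <:].

Lemma zdval_zerodiag (x : zdmx) : zdval x \in zerodiag.
Proof. exact: valP. Qed.

Lemma zerodiagM3 M N P : M \in zerodiag -> N \in zerodiag -> P \in zerodiag ->
  M * (N * P) \in zerodiag.
Proof.
move=> /forallP M0 /forallP N0 /forallP P0; apply/forallP => i.
rewrite mxE big1 // => j _; rewrite mxE mulr_sumr big1 // => k _.
have [->|ij] := eqVneq i j; first by rewrite (eqP (M0 j)) mul0r.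
have [->|jk] := eqVneq j k; first by rewrite (eqP (N0 k)) mul0r mulr0.
have -> : i = k; last by rewrite (eqP (P0 k)) !mulr0.
by apply/val_inj; case: i j k ij jk {M0 N0 P0}
  => [[|[|//]] ?] [[|[|//]] ?] [[|[|//]] ?].
Qed.

Lemma symsum_zerodiag (x y z : zdmx) :
  symsum (zdval x) (zdval y) (zdval z) \in zerodiag.
Proof.
rewrite /symsum /jordan -!scalerAr !mulrDr.
by rewrite !rpredD // rpredZ // rpredD // zerodiagM3 // zdval_zerodiag.
Qed.

(* A^omega is [zdmx] equipped with this operation. *)
Definition zd_symsum (x y z : zdmx) : zdmx := ZDmx (symsum_zerodiag x y z).

Lemma delta_zerodiag (i j : 'I_2) : i != j -> delta_mx i j \in zerodiag.
Proof.
move=> ij; apply/forallP => k; rewrite mxE.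
by case: (eqVneq k i) => // ->; rewrite (negPf ij).
Qed.

Definition zd_e1 : zdmx := ZDmx (@delta_zerodiag ord0 ord_max isT).
Definition zd_e2 : zdmx := ZDmx (@delta_zerodiag ord_max ord0 isT).

Lemma zd_basis (x : zdmx) :
  x = zdval x ord0 ord_max *: zd_e1 + zdval x ord_max ord0 *: zd_e2.
Proof.
apply/val_inj/matrixP => i j; rewrite !mxE /=.
have /forallP x0 := zdval_zerodiag x.
case: i j => [[|[|//]] ilt] [[|[|//]] jlt] /=;
  rewrite ?eqxx ?mulr0 ?mulr1 ?addr0 ?add0r.
- by rewrite (_ : Ordinal jlt = Ordinal ilt) ?(eqP (x0 _)) //; apply/val_inj.
- by congr (zdval x _ _); apply/val_inj.
- by congr (zdval x _ _); apply/val_inj.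
- by rewrite (_ : Ordinal jlt = Ordinal ilt) ?(eqP (x0 _)) //; apply/val_inj.
Qed.

Definition phi (x : zdmx) : free2 F :=
  zdval x ord0 ord_max *: free_a F + zdval x ord_max ord0 *: free_b F.

Fact phi_is_linear : linear phi.
Proof.
move=> c x y; rewrite /phi.
have -> : zdval (c *: x + y) = c *: zdval x + zdval y by exact: (linearP val).
rewrite !mxE.
by rewrite !scalerDl scalerDr !scalerA addrACA.
Qed.

HB.instance Definition _ :=
  GRing.isLinear.Build F zdmx (free2 F) *:%R phi phi_is_linear.

Lemma phi_e1 : phi zd_e1 = free_a F.
Proof. by rewrite /phi !mxE /= scale1r scale0r addr0. Qed.

Lemma phi_e2 : phi zd_e2 = free_b F.
Proof. by rewrite /phi !mxE /= scale1r scale0r add0r. Qed.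

Lemma aug_phi x : aug (phi x) = 0.
Proof. by rewrite augD !augZ aug_a aug_b !mulr0 addr0. Qed.

End ZeroDiagonal.

Section Envelope.
Variable F : fieldType.

Definition env_rel (r : free2 F) : Prop :=
  exists x y z : zdmx F,
    [/\ x \in [:: zd_e1 F; zd_e2 F], y \in [:: zd_e1 F; zd_e2 F],
        z \in [:: zd_e1 F; zd_e2 F]
      & r = symsum (phi x) (phi y) (phi z) - phi (zd_symsum x y z)].

Lemma aug_env_rel r : env_rel r -> aug r = 0.
Proof.
move=> [x [y [z [_ _ _ ->]]]]; rewrite augB (aug_phi (zd_symsum x y z)) subr0.
by rewrite /symsum !augD !augM !aug_phi !mul0r !addr0.
Qed.

Lemma env_proper : ~ ideal_gen env_rel 1.
Proof. exact: aug_proper aug_env_rel. Qed.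

(* U(A^omega), for omega the symmetric sum *)
Definition envelope : algType F := quot_alg env_proper.

Definition env_a : envelope := quot_pi env_proper (free_a F).
Definition env_b : envelope := quot_pi env_proper (free_b F).

End Envelope.

Section DownUp.
Variables (F : fieldType) (alpha beta gamma : F).

Local Notation a := (free_a F).
Local Notation b := (free_b F).

Definition downup_rel (r : free2 F) : Prop :=
     r = b ^+ 2 * a
         - (alpha *: (b * a * b) + beta *: (a * b ^+ 2) + gamma *: b)
  \/ r = b * a ^+ 2
         - (alpha *: (a * b * a) + beta *: (a ^+ 2 * b) + gamma *: a).

Lemma aug_downup_rel r : downup_rel r -> aug r = 0.
Proof.
by case=> ->; rewrite augB !augD !augZ !augM ?expr2 ?augM aug_a aug_b
  !(mulr0, mul0r, addr0, subr0).
Qed.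

Lemma downup_proper : ~ ideal_gen downup_rel 1.
Proof. exact: aug_proper aug_downup_rel. Qed.

(* A(alpha, beta, gamma) *)
Definition downup : algType F := quot_alg downup_proper.

Definition du_a : downup := quot_pi downup_proper (free_a F).
Definition du_b : downup := quot_pi downup_proper (free_b F).

Definition du_cubes (d : downup) : Prop := d = du_a ^+ 3 \/ d = du_b ^+ 3.

Lemma du_cubes_proper : ~ ideal_gen du_cubes 1.
Proof.
apply: aug_proper2 aug_downup_rel _ => _ [] ->.
- by exists (a ^+ 3); rewrite ?rmorphXn //= ?aug_a ?aug_b expr0n.
- by exists (b ^+ 3); rewrite ?rmorphXn //= ?aug_a ?aug_b expr0n.
Qed.

(* A(alpha, beta, gamma) / (a^3, b^3) *)
Definition downup_cubes : algType F := quot_alg du_cubes_proper.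

Definition duc_a : downup_cubes := quot_pi du_cubes_proper du_a.
Definition duc_b : downup_cubes := quot_pi du_cubes_proper du_b.

End DownUp.

(* Main.v *)
Require Import Defs.
From HB Require Import structures.
From mathcomp Require Import all_boot all_algebra.

Set Implicit Arguments.
Unset Strict Implicit.
Unset Printing Implicit Defensive.

Import GRing.Theory.

Local Open Scope ring_scope.

(** The symmetric sum is half the sum of the six permuted products. Evaluated on
    [x, x, x] it is [3 x^3] and on [x, x, y] it is [x^2 y + x y x + y x^2], and it
    is invariant under rotation of its arguments, so in characteristic not 2 or 3
    the eight defining relations of the envelope say exactly that [a^3 = b^3 = 0]
    and that the two down-up relations hold. Both algebras are therefore quotients
    of the free algebra by the same ideal. *)

(** * Universal property of a quotient by a two-sided ideal *)

Section QuotientLift.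
Variables (F : fieldType) (B : algType F) (S : B -> Prop).
Hypothesis S_proper : ~ ideal_gen S 1.
Local Notation pi := (quot_pi S_proper).

Lemma quot_pi_rel s : S s -> pi s = 0.
Proof.
move=> Ss; rewrite -(raddf0 pi); apply/quot_piP/ideal_genP.
by rewrite subr0; apply: ideal_gen_sub.
Qed.

Variables (C : algType F) (g : {lrmorphism B -> C}).

(** The vanishing of [g] on [S] is an argument of the definition so that the morphism instances
    declared below, which depend on it, can attach to the map. *)
Definition quot_lift of (forall s, S s -> g s = 0) :=
  fun q : quot_alg S_proper => g (quot_repr q).

Hypothesis gS : forall s, S s -> g s = 0.
Local Notation lift := (quot_lift gS).

(** The kernel of [g] is a two-sided ideal containing [S]. *)
Lemma ideal_gen_ker x : ideal_gen S x -> g x = 0.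
Proof.
move=> Sx; apply: (Sx (fun y => g y = 0)) gS.
split=> [|y z y0 z0|u y v y0]; first exact: raddf0.
  by rewrite raddfD /= y0 z0 addr0.
by rewrite !rmorphM /= y0 mulr0 mul0r.
Qed.

Lemma quot_lift_pi x : lift (pi x) = g x.
Proof.
apply/eqP; rewrite -subr_eq0 -raddfB; apply/eqP/ideal_gen_ker/ideal_genP.
by apply/(quot_piP S_proper); rewrite quot_reprK.
Qed.

Fact quot_lift_is_zmod_morphism : zmod_morphism lift.
Proof.
move=> p q; have [x ->] := quot_pi_surj p.
have [y ->] := quot_pi_surj q.
by rewrite -raddfB !quot_lift_pi raddfB.
Qed.

Fact quot_lift_is_monoid_morphism : monoid_morphism lift.
Proof.
split=> [|p q]; first by rewrite -(rmorph1 pi) quot_lift_pi rmorph1.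
have [x ->] := quot_pi_surj p; have [y ->] := quot_pi_surj q.
by rewrite -rmorphM !quot_lift_pi rmorphM.
Qed.

Fact quot_lift_is_scalable : scalable lift.
Proof.
move=> c p; have [x ->] := quot_pi_surj p.
by rewrite -quot_piZ !quot_lift_pi linearZ.
Qed.

HB.instance Definition _ := GRing.isZmodMorphism.Build
  (quot_alg S_proper) C lift quot_lift_is_zmod_morphism.
HB.instance Definition _ := GRing.isMonoidMorphism.Build
  (quot_alg S_proper) C lift quot_lift_is_monoid_morphism.
HB.instance Definition _ := GRing.isScalable.Build
  F (quot_alg S_proper) C *:%R lift quot_lift_is_scalable.

End QuotientLift.

(** * Symmetric sum at repeated arguments *)

Section SymmetricSum.
Variables (F : fieldType) (B : algType F).
Implicit Types x y z : B.

Lemma symsum_rot x y z : symsum x y z = symsum y z x.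
Proof. by rewrite /symsum -addrA addrC. Qed.

Hypothesis two_neq0 : 2%:R != 0 :> F.

Lemma jordan_diag x : jordan x x = x * x.
Proof. by rewrite /jordan -mulr2n -scaler_nat scalerA mulVf ?scale1r. Qed.

Lemma symsum_xxx x : symsum x x x = 3%:R *: x ^+ 3.
Proof.
by rewrite /symsum jordan_diag -expr2 -exprS scaler_nat !mulrSr mulr0n add0r.
Qed.

Lemma symsum_xxy x y :
  symsum x x y = x ^+ 2 * y + x * y * x + y * x ^+ 2.
Proof.
(* Reordering one Jordan product makes the two mixed terms equal; their sum cancels the factor
   1/2. *)
rewrite /symsum jordan_diag /jordan (addrC (y * x)) -mulr2n -scaler_nat.
by rewrite -scalerAr scalerA divff // scale1r mulrDr !mulrA expr2.
Qed.

End SymmetricSum.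

(** * Explicit relators of the envelope *)

Section EnvelopeRelations.
Variable F : fieldType.
Local Notation e1 := (zd_e1 F).
Local Notation e2 := (zd_e2 F).
Local Notation a := (free_a F).
Local Notation b := (free_b F).

Lemma zd_symsum_rot (x y z : zdmx F) : zd_symsum x y z = zd_symsum y z x.
Proof. by apply/val_inj; rewrite /= symsum_rot. Qed.

Hypothesis two_neq0 : 2%:R != 0 :> F.

Lemma zd_symsum_111 : zd_symsum e1 e1 e1 = 0.
Proof.
apply/val_inj; rewrite /= symsum_xxx // exprS expr2 -!mulmxE.
by rewrite mul_delta_mx_0 // mulmx0 scaler0.
Qed.

Lemma zd_symsum_222 : zd_symsum e2 e2 e2 = 0.
Proof.
apply/val_inj; rewrite /= symsum_xxx // exprS expr2 -!mulmxE.
by rewrite mul_delta_mx_0 // mulmx0 scaler0.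
Qed.

(** Since [e1] squares to zero, only the middle product [e1 e2 e1 = e1] survives. *)
Lemma zd_symsum_112 : zd_symsum e1 e1 e2 = e1.
Proof.
apply/val_inj; rewrite /= symsum_xxy // expr2 -!mulmxE.
by rewrite !mul_delta_mx mul_delta_mx_0 // mulmx0 mul0mx addr0 add0r.
Qed.

Lemma zd_symsum_221 : zd_symsum e2 e2 e1 = e2.
Proof.
apply/val_inj; rewrite /= symsum_xxy // expr2 -!mulmxE.
by rewrite !mul_delta_mx mul_delta_mx_0 // mulmx0 mul0mx addr0 add0r.
Qed.

(** The eight triples of basis vectors form four orbits under rotation, one for each relator. *)
Lemma env_relE r : env_rel r <->
  [\/ r = 3%:R *: a ^+ 3, r = 3%:R *: b ^+ 3,
      r = b ^+ 2 * a + b * a * b + a * b ^+ 2 - b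
    | r = a ^+ 2 * b + a * b * a + b * a ^+ 2 - a].
Proof.
pose rel (x y z : zdmx F) :=
  symsum (phi x) (phi y) (phi z) - phi (zd_symsum x y z).
have rel_rot (x y z : zdmx F) : rel x y z = rel y z x.
  by rewrite /rel symsum_rot zd_symsum_rot.
have rel111 : rel e1 e1 e1 = 3%:R *: a ^+ 3.
  by rewrite /rel zd_symsum_111 raddf0 subr0 phi_e1 symsum_xxx.
have rel222 : rel e2 e2 e2 = 3%:R *: b ^+ 3.
  by rewrite /rel zd_symsum_222 raddf0 subr0 phi_e2 symsum_xxx.
have rel221 : rel e2 e2 e1 = b ^+ 2 * a + b * a * b + a * b ^+ 2 - b.
  by rewrite /rel zd_symsum_221 phi_e1 phi_e2 symsum_xxy.
have rel112 : rel e1 e1 e2 = a ^+ 2 * b + a * b * a + b * a ^+ 2 - a.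
  by rewrite /rel zd_symsum_112 phi_e1 phi_e2 symsum_xxy.
split=> [[x [y [z []]]]|]; last first.
  case=> ->; [exists e1, e1, e1|exists e2, e2, e2|exists e2, e2, e1
             |exists e1, e1, e2]; by rewrite !inE !eqxx ?orbT; split.
rewrite !inE => /orP[] /eqP-> /orP[] /eqP-> /orP[] /eqP-> ->.
- exact: Or41.
- exact: Or44.
- by rewrite -/(rel e1 e2 e1) -rel_rot; apply: Or44.
- by rewrite -/(rel e1 e2 e2) rel_rot; apply: Or43.
- by rewrite -/(rel e2 e1 e1) rel_rot; apply: Or44.
- by rewrite -/(rel e2 e1 e2) -rel_rot; apply: Or43.
- exact: Or43.
- exact: Or42.
Qed.

End EnvelopeRelations.

(** * Isomorphism with the quotient of the down-up algebra *)

Section Isomorphism.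
Variable F : fieldType.
Hypotheses (two_neq0 : 2%:R != 0 :> F) (three_neq0 : 3%:R != 0 :> F).
Local Notation pe := (quot_pi (@env_proper F)).
Local Notation pd := (quot_pi (@downup_proper F (-1) (-1) 1)).
Local Notation pc := (quot_pi (@du_cubes_proper F (-1) (-1) 1)).
Local Notation a := (free_a F).
Local Notation b := (free_b F).

Lemma downup_baE (x y : free2 F) :
  y ^+ 2 * x - (-1 *: (y * x * y) + -1 *: (x * y ^+ 2) + 1 *: y) =
  y ^+ 2 * x + y * x * y + x * y ^+ 2 - y.
Proof. by rewrite !scaleN1r scale1r !opprD !opprK !addrA. Qed.

Lemma downup_abE (x y : free2 F) :
  y * x ^+ 2 - (-1 *: (x * y * x) + -1 *: (x ^+ 2 * y) + 1 *: x) =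
  x ^+ 2 * y + x * y * x + y * x ^+ 2 - x.
Proof.
rewrite !scaleN1r scale1r !opprD !opprK !addrA; congr (_ - _).
by rewrite addrC addrA (addrAC _ (y * _)).
Qed.

(** The relator is three times the cube, so 3 has to be inverted. *)
Lemma pe_cube_a : pe (a ^+ 3) = 0.
Proof.
rewrite -[a ^+ 3]scale1r -(mulVf three_neq0) -scalerA linearZ /=.
by rewrite quot_pi_rel ?scaler0 //; apply/env_relE => //; apply: Or41.
Qed.

Lemma pe_cube_b : pe (b ^+ 3) = 0.
Proof.
rewrite -[b ^+ 3]scale1r -(mulVf three_neq0) -scalerA linearZ /=.
by rewrite quot_pi_rel ?scaler0 //; apply/env_relE => //; apply: Or42.
Qed.

Lemma pe_downup_rel s : @downup_rel F (-1) (-1) 1 s -> pe s = 0.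
Proof.
move=> s_rel; apply/quot_pi_rel/env_relE => //.
by case: s_rel => ->; rewrite ?downup_baE ?downup_abE; [apply: Or43|apply: Or44].
Qed.

(** First of two lifts: [downup_cubes] is a quotient of a quotient, so the map to the envelope is
    built one quotient at a time. *)
Definition downup_to_env : {lrmorphism @downup F (-1) (-1) 1 -> envelope F} :=
  quot_lift pe_downup_rel.

Lemma downup_to_env_cubes d :
  @du_cubes F (-1) (-1) 1 d -> downup_to_env d = 0.
Proof.
case=> ->; rewrite -(rmorphXn pd) [LHS]quot_lift_pi.
  exact: pe_cube_a.
exact: pe_cube_b.
Qed.

Definition cubes_to_env :
    {lrmorphism @downup_cubes F (-1) (-1) 1 -> envelope F} :=
  quot_lift downup_to_env_cubes.

Lemma cubes_to_env_pi x : cubes_to_env (pc (pd x)) = pe x.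
Proof. by rewrite [LHS]quot_lift_pi [LHS]quot_lift_pi. Qed.

Definition free_to_cubes : {lrmorphism free2 F -> @downup_cubes F (-1) (-1) 1} :=
  pc \o pd.

(** The cubes die in the outer quotient, the other two relators already in the down-up algebra. *)
Lemma free_to_cubes_rel s : env_rel s -> free_to_cubes s = 0.
Proof.
move=> /env_relE-/(_ two_neq0)[] -> /=.
- rewrite linearZ /= linearZ /= rmorphXn /= [pc _]quot_pi_rel ?scaler0 //.
  by left.
- rewrite linearZ /= linearZ /= rmorphXn /= [pc _]quot_pi_rel ?scaler0 //.
  by right.
- by rewrite [pd _]quot_pi_rel ?raddf0 //; left; rewrite downup_baE.
- by rewrite [pd _]quot_pi_rel ?raddf0 //; right; rewrite downup_abE.
Qed.

Lemma cubes_to_env_bij : bijective cubes_to_env.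
Proof.
(* Both maps send the class of a free element [x] to the class of [x], and every element of either
   algebra is such a class. *)
exists (quot_lift (S_proper := @env_proper F) free_to_cubes_rel) => q.
  have [d ->] := quot_pi_surj q; have [x ->] := quot_pi_surj d.
  by rewrite cubes_to_env_pi quot_lift_pi.
have [x ->] := quot_pi_surj q.
by rewrite quot_lift_pi cubes_to_env_pi.
Qed.

End Isomorphism.

Theorem corollary4p5 (F : fieldType) (F_char0 : [pchar F] =i pred0) :
  let a : envelope F := env_a F in
  let b : envelope F := env_b F in
  [/\ a ^+ 3 = 0, b ^+ 3 = 0,
      b ^+ 2 * a = - (b * a * b) - a * b ^+ 2 + b
    & b * a ^+ 2 = - (a * b * a) - a ^+ 2 * b + a]
  /\ exists f : {lrmorphism downup_cubes (-1 : F) (-1) 1 -> envelope F},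
       [/\ bijective f, f (duc_a (-1) (-1) 1) = a & f (duc_b (-1) (-1) 1) = b].
Proof.
have n_neq0 n : n.+1%:R != 0 :> F by rewrite (pcharf0P F).1.
move=> a b; split; last first.
  exists (cubes_to_env (n_neq0 1) (n_neq0 2)).
  by split; [exact: cubes_to_env_bij | exact: cubes_to_env_pi..].
split.
- by rewrite -rmorphXn; apply: pe_cube_a.
- by rewrite -rmorphXn; apply: pe_cube_b.
- have rel : b ^+ 2 * a + b * a * b + a * b ^+ 2 = b.
    (* The zero on the right is replaced by the image of the first down-up relator. *)
    apply: subr0_eq; rewrite -[RHS](pe_downup_rel (n_neq0 1) (or_introl erefl)).
    by rewrite downup_baE !(rmorphB, rmorphD, rmorphM, rmorphXn).
  (* Only the final [b] is expanded by [rel]; the other terms then cancel. *)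
  by rewrite -[X in _ = _ + X]rel -opprD addrC -(addrA (b ^+ 2 * a)) addrK.
- have rel : a ^+ 2 * b + a * b * a + b * a ^+ 2 = a.
    apply: subr0_eq; rewrite -[RHS](pe_downup_rel (n_neq0 1) (or_intror erefl)).
    by rewrite downup_abE !(rmorphB, rmorphD, rmorphM, rmorphXn).
  by rewrite -[X in _ = _ + X]rel -opprD (addrC (a * b * a)) addKr.
Qed.
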